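(* Let $\mathcal{H}(\Omega_1),\ldots,\mathcal{H}(\Omega_n)$ be reproducing kernel Hilbert spaces on non-empty sets $\Omega_1,\ldots,\Omega_n$, and let $\mathbf{A}=[A_{ij}]_{i,j=1}^n$ be an $n\times n$ operator matrix with $A_{ij}\in\mathcal{B}(\mathcal{H}(\Omega_j),\mathcal{H}(\Omega_i))$. Then $$\mathbf{ber}(\mathbf{A})\le w\left([a_{ij}]_{i,j=1}^n\right),$$ where $$a_{ij}=\begin{cases}\mathbf{ber}(A_{ii}) & \text{if } i=j,\\ \sqrt{\left(\|A_{ij}\|_{ber}+\|A_{ji}^*\|_{ber}\right)^2-\left(\|A_{ij}\|_{ber}\|A_{ji}^*\|_{ber}-\mathbf{ber}(A_{ji}A_{ij})\right)} & \text{if } i<j,\\ 0 & \text{if } i>j.\end{cases}$$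
   Context: A reproducing kernel Hilbert space $\mathcal{H}(\Omega)$ is a Hilbert space of complex-valued functions on a non-empty set $\Omega$ on which all point evaluations are continuous; $k_\lambda\in\mathcal{H}(\Omega)$ denotes the reproducing kernel at $\lambda\in\Omega$, i.e. $f(\lambda)=\langle f,k_\lambda\rangle$ for all $f\in\mathcal{H}(\Omega)$, and $\hat k_\lambda=k_\lambda/\|k_\lambda\|$ is the normalized reproducing kernel (kernels are assumed non-zero). For $A\in\mathcal{B}(\mathcal{H}(\Omega))$ the Berezin radius is $\mathbf{ber}(A)=\sup\{|\langle A\hat k_\lambda,\hat k_\lambda\rangle|:\lambda\in\Omega\}$. For $A\in\mathcal{B}(\mathcal{H}(\Omega),\mathcal{H}(\Omega'))$ the Berezin norm is $\|A\|_{ber}=\sup\{\|A\hat k_\lambda\|:\lambda\in\Omega\}$. The direct sum $\oplus_{i=1}^n\mathcal{H}(\Omega_i)$ is treated as a reproducing kernel Hilbert space on $\Omega_1\times\cdots\times\Omega_n$, where the normalized reproducing kernel at $(\lambda_1,\ldots,\lambda_n)$ is the vector $(k_{\lambda_1},\ldots,k_{\lambda_n})$ divided by its norm $\left(\sum_{i}\|k_{\lambda_i}\|^2\right)^{1/2}$, and $\mathbf{ber}(\mathbf{A})$ is the supremum over all $(\lambda_1,\ldots,\lambda_n)$ of $|\langle\mathbf{A}\hat k_{(\lambda_1,\ldots,\lambda_n)},\hat k_{(\lambda_1,\ldots,\lambda_n)}\rangle|$. The operator matrix acts by $(\mathbf{A}x)_i=\sum_j A_{ij}x_j$. For a complex $n\times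 n$ matrix $M$, $w(M)=\sup\{|\langle Mx,x\rangle|:x\in\mathbb{C}^n,\|x\|=1\}$ is the numerical radius. *)

(* Defs.v *)
From HB Require Import structures.
From mathcomp Require Import all_boot all_order all_algebra.
From mathcomp Require Import complex.
From mathcomp Require Import all_classical all_reals all_analysis.
Set Implicit Arguments.
Unset Strict Implicit.
Unset Printing Implicit Defensive.
Import Order.TTheory GRing.Theory Num.Theory.
Import numFieldNormedType.Exports.
Local Open Scope classical_set_scope.
Local Open Scope ring_scope.

(* The complex numbers are [R[i]]. Norms over [R[i]] take their values in
   [R[i]] (in its nonnegative reals); [rnorm] is the same norm seen in [R], so
   that suprema can be taken. On [R[i]] itself it is the modulus. *)
Definition rnorm (R : realType) (V : normedZmodType R[i]) (v : V) : R :=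
  complex.Re `|v|.

(* The element [f : carrier] stands for the function [fun l => eval l f];
   by linearity of [eval l] and [eval_inj] this identifies [carrier] with a
   linear space of functions on [Omega]. Inner products ([{dot _ for _}]) are
   linear in the first argument and conjugate-linear in the second. *)
Record rkhs (R : realType) (Omega : Type) := Rkhs {
  carrier :> completeNormedModType R[i] ;
  dotp : {dot carrier for Num.conj} ;
  dotp_norm : forall f : carrier, dotp f f = `|f| ^+ 2 ;
  eval : Omega -> {linear carrier -> R[i]^o} ;
  eval_inj : forall f g : carrier, (forall l, eval l f = eval l g) -> f = g ;
  eval_continuous : forall l : Omega, continuous (eval l) }.

(* [xget 0 P] is an element of [P] if there is one, and [0] otherwise. In
   [rker], and in [adjoint] for a continuous linear [A], the Riesz
   representation theorem provides the (unique) element. *)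
Definition rker (R : realType) (Omega : Type) (H : rkhs R Omega)
    (l : Omega) : H :=
  xget 0 [set k : H | forall f : H, eval H l f = dotp H f k].

Definition nker (R : realType) (Omega : Type) (H : rkhs R Omega)
    (l : Omega) : H :=
  `|rker H l|^-1 *: rker H l.

Definition adjoint (R : realType) (Omega Omega' : Type) (H : rkhs R Omega)
    (K : rkhs R Omega') (A : H -> K) (y : K) : H :=
  xget 0 [set z : H | forall x : H, dotp K (A x) y = dotp H x z].

(* [sup] is the true supremum on nonempty bounded sets only (it is [0]
   otherwise); continuous linear maps and nonempty [Omega] give such sets. *)
Definition ber (R : realType) (Omega : Type) (H : rkhs R Omega)
    (A : H -> H) : R :=
  sup [set rnorm (dotp H (A (nker H l)) (nker H l)) | l in setT].

Definition ber_norm (R : realType) (Omega Omega' : Type) (H : rkhs R Omega)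
    (K : rkhs R Omega') (A : H -> K) : R :=
  sup [set rnorm (A (nker H l)) | l in setT].

Section DirectSum.
Variables (R : realType) (n : nat) (Omega : 'I_n -> Type).
Variable H : forall i, rkhs R (Omega i).

Definition dsum := forall i, H i.

Definition dsum_dotp (x y : dsum) : R[i] := \sum_i dotp (H i) (x i) (y i).

Definition dsum_norm (x : dsum) : R := Num.sqrt (\sum_i rnorm (x i) ^+ 2).

Definition dsum_rker (l : forall i, Omega i) : dsum :=
  fun i => rker (H i) (l i).

Definition dsum_nker (l : forall i, Omega i) : dsum :=
  fun i => ((dsum_norm (dsum_rker l))^-1)%:C%C *: dsum_rker l i.

Definition opmx (A : forall i j, H j -> H i) (x : dsum) : dsum :=
  fun i => \sum_j A i j (x j).

Definition dsum_ber (T : dsum -> dsum) : R :=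
  sup [set rnorm (dsum_dotp (T (dsum_nker l)) (dsum_nker l)) | l in setT].

End DirectSum.

Definition numerical_radius (R : realType) (n : nat) (M : 'M[R[i]]_n) : R :=
  sup [set rnorm (\sum_i (M *m x) i 0 * Num.conj (x i 0))
      | x in [set x : 'cV[R[i]]_n | Num.sqrt (\sum_i rnorm (x i 0) ^+ 2) = 1]].

(* Main.v *)
Require Import Defs.
From HB Require Import structures.
From mathcomp Require Import all_boot all_order all_algebra.
From mathcomp Require Import complex.
From mathcomp Require Import all_classical all_reals all_analysis.
From mathcomp Require Import ring lra.
Import Order.TTheory GRing.Theory Num.Theory.
Import numFieldNormedType.Exports.
Local Open Scope classical_set_scope.
Local Open Scope ring_scope.

Set Implicit Arguments.
Unset Strict Implicit.
Unset Printing Implicit Defensive.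

(** Write [k_i] for the normalized kernel of the i-th space at [l i]. The
normalized kernel of the direct sum at [l] is [(u_i k_i)_i] for a real unit
vector [u] with nonnegative entries, so its Berezin value is at most
[\sum_(i, j) u_i u_j t_ij] with [t_ij = |<A_ij k_j, k_i>|]. The numerical
radius of [a] is at least [\sum_(i, j) u_i u_j a_ij], its quadratic form at
[u]. Since the weights [u_i u_j] are symmetric, only
[t_ij + t_ji <= a_ij + a_ji] is needed ([sum_sym_le]).

On the diagonal this is the definition of the Berezin radius. For [i < j], put
[x = A_ij k_j], [y = A_ji^* k_j] and [e = k_i], so that [t_ij = |<x, e>|] and
[t_ji = |<e, y>|]. Expanding the square and applying Cauchy-Schwarz to the two
squares and Buzano's inequality
[2 |<x, e>| |<e, y>| <= |x| |y| + |<x, y>|] to the cross term gives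
[(t_ij + t_ji)^2 <= |x|^2 + |y|^2 + |x| |y| + |<x, y>|]
([add_inner_unit_le]). Here [|x|] and [|y|] are bounded by Berezin norms and
[<x, y> = <A_ji A_ij k_j, k_j>] by a Berezin radius, and the resulting bound
[a^2 + b^2 + a b + c] is [(a + b)^2 - (a b - c)], the square of [a_ij]
([ber_cross_terms_le]).

The identity [t_ji = |<e, y>|] needs a genuine Hilbert adjoint of [A_ji]; it
comes from the Riesz representation theorem ([riesz]), proved by minimizing
[|x|^2 - 2 Re (phi x)]. Boundedness of all the operators, adjoints included,
makes every supremum involved an upper bound. *)

(** * Real-valued norms over the complex numbers *)

Section RealNorm.
Variable R : realType.

Lemma normE_rnorm (V : normedZmodType R[i]) (v : V) : `|v| = (rnorm v)%:C%C.
Proof. by rewrite RRe_real// ger0_real. Qed.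

Lemma rnorm_ge0 (V : normedZmodType R[i]) (v : V) : 0 <= rnorm v.
Proof. by rewrite -ler0c -normE_rnorm. Qed.

Lemma rnorm0 (V : normedZmodType R[i]) : rnorm (0 : V) = 0.
Proof. by rewrite /rnorm normr0. Qed.

Lemma rnormN (V : normedZmodType R[i]) (v : V) : rnorm (- v) = rnorm v.
Proof. by rewrite /rnorm normrN. Qed.

Lemma ler_rnormD (V : normedZmodType R[i]) (v w : V) :
  rnorm (v + w) <= rnorm v + rnorm w.
Proof. by rewrite -lecR rmorphD/= -!normE_rnorm ler_normD. Qed.

Lemma rnorm_eq0 (V : normedZmodType R[i]) (v : V) : (rnorm v == 0) = (v == 0).
Proof. by rewrite -(normr_eq0 v) normE_rnorm -(inj_eq (@complexI R)). Qed.

Lemma rnorm_gt0 (V : normedZmodType R[i]) (v : V) : (0 < rnorm v) = (v != 0).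
Proof. by rewrite lt_def rnorm_eq0 rnorm_ge0 andbT. Qed.

Lemma rnormZ (V : normedModType R[i]) (c : R[i]) (v : V) :
  rnorm (c *: v) = rnorm c * rnorm v.
Proof. by apply: (@complexI R); rewrite rmorphM/= -!normE_rnorm normrZ. Qed.

Lemma rnormM (a b : R[i]) : rnorm (a * b) = rnorm a * rnorm b.
Proof. by apply: (@complexI R); rewrite rmorphM/= -!normE_rnorm normrM. Qed.

Lemma rnorm_conj (a : R[i]) : rnorm (Num.conj a) = rnorm a.
Proof. by rewrite /rnorm norm_conjC. Qed.

Lemma rnorm_real (x : R) : rnorm (x%:C%C : R[i]) = `|x|.
Proof. by rewrite /rnorm normc_def/= expr0n addr0 sqrtr_sqr. Qed.

Lemma ler_rnorm_sum (V : normedZmodType R[i]) (I : finType) (P : pred I)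
    (F : I -> V) :
  rnorm (\sum_(i | P i) F i) <= \sum_(i | P i) rnorm (F i).
Proof.
elim/big_rec2: _ => [|i y1 y2 _ h]; first by rewrite rnorm0.
by apply: (le_trans (ler_rnormD _ _)); rewrite lerD2l.
Qed.

Lemma Re_le_rnorm (a : R[i]) : complex.Re a <= rnorm a.
Proof.
apply: (le_trans (ler_norm _)).
by rewrite -lecR -normE_rnorm; exact: normc_ge_Re.
Qed.

(** For [N > 0], the quadratic [E + |c|^2 N - 2 Re (c p)] in the complex [c] has
minimum [E - |p|^2 / N], attained at [c = p^* / N]. This is the common core of
Cauchy-Schwarz and of the variational argument in the Riesz theorem. *)
Lemma complex_discriminant (E N : R) (p : R[i]) : 0 <= N ->
  (forall c : R[i], 0 <= E + rnorm c ^+ 2 * N - 2 * complex.Re (c * p)) ->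
  rnorm p ^+ 2 <= E * N.
Proof.
move=> N0 H.
have K (t : R) : 0 <= E + t ^+ 2 * rnorm p ^+ 2 * N - 2 * t * rnorm p ^+ 2.
  have := H (t%:C%C * Num.conj p).
  rewrite rnormM rnorm_conj rnorm_real exprMn real_normK ?num_real//.
  rewrite -mulrA [Num.conj p * p]mulrC -normCK normE_rnorm -rmorphXn -rmorphM/=.
  by rewrite (mulrA 2).
have [N00|Nn0] := eqVneq N 0.
  rewrite N00 mulr0.
  have [->//|p0] := eqVneq (rnorm p ^+ 2) 0.
  (* The expression is now affine in t; this t makes it equal to -1. *)
  have := K ((E + 1) / (2 * rnorm p ^+ 2)).
  have -> : E + ((E + 1) / (2 * rnorm p ^+ 2)) ^+ 2 * rnorm p ^+ 2 * N
    - 2 * ((E + 1) / (2 * rnorm p ^+ 2)) * rnorm p ^+ 2 = -1.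
    by rewrite N00; move: (rnorm p ^+ 2) p0 => q q0; field.
  by rewrite lerNr oppr0 ler10.
have Npos : 0 < N by rewrite lt_def Nn0.
have := K N^-1.
have -> : E + N^-1 ^+ 2 * rnorm p ^+ 2 * N - 2 * N^-1 * rnorm p ^+ 2
   = E - rnorm p ^+ 2 / N by field.
by rewrite subr_ge0 ler_pdivrMr.
Qed.

End RealNorm.

(** * Inequalities and Riesz representation in a Hilbert space *)

Section HilbertSpace.
Variables (R : realType) (V : completeNormedModType R[i]).
Variable dot : {dot V for Num.conj}.
Hypothesis dot_norm : forall x : V, dot x x = `|x| ^+ 2.

Let dotC x y : dot x y = Num.conj (dot y x).
Proof. by rewrite hermC/= expr0 mul1r. Qed.

Let dotDl x y z : dot (x + y) z = dot x z + dot y z.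
Proof. by rewrite linearDl. Qed.

Let dotBl x y z : dot (x - y) z = dot x z - dot y z.
Proof. by rewrite linearBl. Qed.

Let dotZl c x z : dot (c *: x) z = c * dot x z.
Proof. by rewrite linearZl_LR. Qed.

Let dotDr x y z : dot z (x + y) = dot z x + dot z y.
Proof. by rewrite linearDr. Qed.

Let dotBr x y z : dot z (x - y) = dot z x - dot z y.
Proof. by rewrite linearBr. Qed.

Let dotZr c x z : dot z (c *: x) = Num.conj c * dot z x.
Proof. by rewrite linearZr_LR. Qed.

Let ReC (a : R[i]) : complex.Re (Num.conj a) = complex.Re a.
Proof. by case: a. Qed.

Lemma sqr_rnormD (x y : V) :
  rnorm (x + y) ^+ 2 =
  rnorm x ^+ 2 + rnorm y ^+ 2 + 2 * complex.Re (dot x y).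
Proof.
have sqE (z : V) : rnorm z ^+ 2 = complex.Re (dot z z).
  by rewrite dot_norm normE_rnorm -rmorphXn.
rewrite !sqE dotDl !dotDr (dotC y x) !raddfD/= ReC; ring.
Qed.

Lemma sqr_rnormB (x y : V) :
  rnorm (x - y) ^+ 2 =
  rnorm x ^+ 2 + rnorm y ^+ 2 - 2 * complex.Re (dot x y).
Proof.
rewrite sqr_rnormD rnormN -scaleN1r dotZr rmorphN rmorph1 mulN1r raddfN/=.
by rewrite mulrN.
Qed.

(** The discriminant of [|x - c^* y|^2 >= 0] as a quadratic in [c]. *)
Lemma cauchy_schwarz (x y : V) : rnorm (dot x y) <= rnorm x * rnorm y.
Proof.
rewrite -(@ler_pXn2r _ 2)// ?nnegrE ?mulr_ge0 ?rnorm_ge0// exprMn.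
apply: complex_discriminant; first by rewrite exprn_ge0 ?rnorm_ge0.
move=> c; have := sqr_rnormB x (Num.conj c *: y).
rewrite rnormZ rnorm_conj exprMn dotZr conjCK => <-.
by rewrite exprn_ge0 ?rnorm_ge0.
Qed.

(** Buzano's inequality: the reflection [z = x - 2 <x, e> e] of [x] has the
norm of [x], and [2 <x, e> <e, y> = <x, y> - <z, y>]. *)
Lemma buzano (x y e : V) : rnorm e = 1 ->
  2 * (rnorm (dot x e) * rnorm (dot e y)) <=
  rnorm x * rnorm y + rnorm (dot x y).
Proof.
move=> e1; pose z := x - (2 * dot x e) *: e.
have zx : rnorm z = rnorm x.
  apply/eqP; rewrite -(@eqrXn2 _ 2)// ?rnorm_ge0//; apply/eqP.
  rewrite /z sqr_rnormB rnormZ e1 mulr1 dotZr rmorphM/= -mulrA -normCKC.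
  rewrite normE_rnorm -rmorphXn rnormM exprMn.
  have -> : rnorm (2 : R[i]) = 2 by rewrite /rnorm normr_nat; simpc.
  rewrite (conjC_nat _ 2) -(rmorph_nat (real_complex R)) -rmorphM/=; ring.
have -> : 2 * (rnorm (dot x e) * rnorm (dot e y)) =
    rnorm (dot x y - dot z y).
  rewrite /z dotBl dotZl opprB addrC addrNK !rnormM.
  have -> : rnorm (2 : R[i]) = 2 by rewrite /rnorm normr_nat; simpc.
  by rewrite mulrA.
apply: (le_trans (ler_rnormD _ _)); rewrite rnormN addrC lerD2r.
by rewrite -zx cauchy_schwarz.
Qed.

(** The gain over the bound [(|x| + |y|)^2] is in the cross term:
Buzano replaces [2 |x| |y|] by [|x| |y| + |<x, y>|]. *)
Lemma add_inner_unit_le (x y e : V) : rnorm e = 1 ->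
  (rnorm (dot x e) + rnorm (dot e y)) ^+ 2 <=
  rnorm x ^+ 2 + rnorm y ^+ 2 + rnorm x * rnorm y + rnorm (dot x y).
Proof.
move=> e1.
have h1 : rnorm (dot x e) ^+ 2 <= rnorm x ^+ 2.
  rewrite ler_pXn2r ?nnegrE ?rnorm_ge0//.
  by have := cauchy_schwarz x e; rewrite e1 mulr1.
have h2 : rnorm (dot e y) ^+ 2 <= rnorm y ^+ 2.
  rewrite ler_pXn2r ?nnegrE ?rnorm_ge0//.
  by have := cauchy_schwarz e y; rewrite e1 mul1r.
have := buzano x y e1.
by rewrite sqrrD; lra.
Qed.

Section Riesz.
Variables (phi : {linear V -> R[i]^o}) (M : R).
Hypothesis phi_bounded : forall x, rnorm (phi x) <= M * rnorm x.

(** If [phi] is represented by [z], then [J x = |x - z|^2 - |z|^2], so the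
representing vector is sought as the minimizer of [J]. *)
Let J (x : V) : R := rnorm x ^+ 2 - 2 * complex.Re (phi x).

Let J_lbound x : - M ^+ 2 <= J x.
Proof.
have := le_trans (Re_le_rnorm _) (phi_bounded x).
have := sqr_ge0 (rnorm x - M).
by rewrite /J sqrrB; lra.
Qed.

Let has_inf_J : has_inf (range J).
Proof.
split; first by exists (J 0), 0.
by exists (- M ^+ 2) => _ [x _ <-]; exact: J_lbound.
Qed.

Let J_step x h (c : R[i]) : J (x + c *: h) =
  J x + rnorm c ^+ 2 * rnorm h ^+ 2 - 2 * complex.Re (c * (phi h - dot h x)).
Proof.
rewrite /J sqr_rnormD rnormZ exprMn dotZr [dot x h]dotC -rmorphM ReC.
have -> : phi (x + c *: h) = phi x + c * phi h by rewrite linearD linearZ.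
by rewrite mulrBr !raddfD/= raddfN/=; ring.
Qed.

(** A vector that nearly minimizes [J] nearly represents [phi]: moving from [x]
in the direction [h] cannot decrease [J] by more than [e ^+ 2], so the
discriminant bounds the first-order term [phi h - <h, x>]. *)
Let near_minimizer x (e : R) : 0 <= e -> J x <= inf (range J) + e ^+ 2 ->
  forall h, rnorm (phi h - dot h x) <= e * rnorm h.
Proof.
move=> e0 Jx h.
rewrite -(@ler_pXn2r _ 2)// ?nnegrE ?mulr_ge0 ?rnorm_ge0// exprMn.
apply: complex_discriminant; first by rewrite exprn_ge0 ?rnorm_ge0.
move=> c; have : inf (range J) <= J (x + c *: h).
  by apply: ge_inf; [case: has_inf_J|exists (x + c *: h)].
by rewrite J_step; lra.
Qed.

(** Both [x] and [y] nearly represent [phi] on the direction [h = x - y], and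
[|h|^2 = <h, x> - <h, y>]; hence minimizing sequences are Cauchy. *)
Let near_minimizers_close x y (e f : R) : 0 <= e -> 0 <= f ->
  J x <= inf (range J) + e ^+ 2 -> J y <= inf (range J) + f ^+ 2 ->
  rnorm (x - y) <= e + f.
Proof.
move=> e0 f0 /(near_minimizer e0) xP /(near_minimizer f0) yP.
have [/eqP|xy0] := eqVneq (x - y) 0.
  by rewrite -rnorm_eq0 => /eqP ->; rewrite addr_ge0.
rewrite -(@ler_pM2r _ (rnorm (x - y))) ?rnorm_gt0//.
have -> : rnorm (x - y) * rnorm (x - y) = rnorm (dot (x - y) (x - y)).
  by rewrite dot_norm [in RHS]/rnorm normrX normr_id normE_rnorm -rmorphXn.
set h := x - y.
have -> : dot h h = (phi h - dot h y) - (phi h - dot h x).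
  by rewrite dotBr; ring.
apply: (le_trans (ler_rnormD _ _)); rewrite rnormN mulrDl addrC.
exact: lerD.
Qed.

(** Riesz representation: the limit of a minimizing sequence of [J]. *)
Lemma riesz : exists z, forall x, phi x = dot x z.
Proof.
have inv_gt0 m : 0 < (m.+1%:R : R)^-1 by rewrite invr_gt0 ltr0n.
have /choice[u uP] m : exists x, J x <= inf (range J) + m.+1%:R^-1 ^+ 2.
  have e0 : 0 < (m.+1%:R : R)^-1 ^+ 2 by rewrite exprn_gt0.
  by have [_ [x _ <-] /ltW] := inf_adherent e0 has_inf_J; exists x.
have u_close m k : rnorm (u m - u k) <= m.+1%:R^-1 + k.+1%:R^-1.
  by apply: near_minimizers_close => //; exact: ltW.
have inv_small (e : R) : 0 < e ->
    exists N, forall m, (N <= m)%N -> m.+1%:R^-1 < e.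
  move=> e0; have [N _ NP] := near_infty_natSinv_lt (PosNum e0).
  by exists N => m; exact: NP.
have ltC (v : V) (e : R[i]) : 0 < e -> (`|v| < e) = (rnorm v < complex.Re e).
  by rewrite normE_rnorm !ltcE/= => /andP[/eqP -> _]; rewrite eqxx.
have /cauchy_cvgP u_cvg : cauchy (u @ \oo).
  apply/cauchy_exP => e e0.
  have e20 : 0 < complex.Re e / 2.
    by move: e0; rewrite ltcE => /andP[_ ?]; rewrite divr_gt0.
  have [N NP] := inv_small _ e20.
  exists (u N); exists N => // m /= Nm.
  rewrite -ball_normE/= ltC// (le_lt_trans (u_close _ _))//.
  by rewrite [ltRHS]splitr ltrD ?NP.
exists (lim (u @ \oo)) => h; apply/eqP; rewrite -subr_eq0 -rnorm_eq0.
rewrite eq_le rnorm_ge0 andbT; apply/ler_addgt0Pr => e e0; rewrite add0r.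
have e'0 : 0 < e / (rnorm h + 1) / 2.
  by rewrite !divr_gt0// ltr_wpDl ?rnorm_ge0.
have [N NP] := inv_small _ e'0.
have e'C0 : 0 < (e / (rnorm h + 1) / 2)%:C%C :> R[i] by rewrite ltcR.
have /cvgrPdist_lt/(_ _ e'C0)[N' _ N'P] := u_cvg.
pose m := maxn N N'.
have um := NP m (leq_maxl _ _).
have := N'P m (leq_maxr _ _); rewrite /= ltC//= => ul.
have -> : phi h - dot h (lim (u @ \oo)) =
    (phi h - dot h (u m)) - dot h (lim (u @ \oo) - u m).
  by rewrite dotBr; ring.
apply: (le_trans (ler_rnormD _ _)); rewrite rnormN.
have h1 := near_minimizer (ltW (inv_gt0 m)) (uP m) h.
have h2 := cauchy_schwarz h (lim (u @ \oo) - u m).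
apply: (le_trans (lerD h1 h2)); rewrite [leLHS]addrC mulrC -mulrDl.
rewrite (@le_trans _ _ (e / (rnorm h + 1) * rnorm h))//.
  by rewrite ler_wpM2r ?rnorm_ge0// [leRHS]splitr lerD ?ltW.
by rewrite mulrAC ler_pdivrMr ?ltr_wpDl ?rnorm_ge0// ler_pM2l// lerDl.
Qed.

End Riesz.

End HilbertSpace.

(** * Bounded operators and their adjoints *)

Section BoundedOperators.
Variable R : realType.

Lemma continuous_linear_rnorm_bounded (V W : normedModType R[i])
    (f : {linear V -> W}) : continuous f ->
  exists2 M : R, 0 <= M & forall x, rnorm (f x) <= M * rnorm x.
Proof.
move=> /linear_bounded_continuous/linear_boundedP/pinfty_ex_gt0[M M0 fM].
exists (complex.Re M); first by move: M0; rewrite ltcE => /andP[_ /ltW].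
move=> x; move: (fM x); rewrite !normE_rnorm.
by rewrite -{1}(RRe_real (gtr0_real M0)) -rmorphM lecR.
Qed.

Variables (Omega Omega' : Type) (H : rkhs R Omega) (K : rkhs R Omega').

(** [x |-> <A x, y>] is a bounded functional, so Riesz provides the vector that
[adjoint] selects. *)
Lemma adjointP (A : {linear H -> K}) : continuous A ->
  forall x y, dotp K (A x) y = dotp H x (adjoint A y).
Proof.
move=> /continuous_linear_rnorm_bounded[M M0 AM] x y.
pose phi (x : H) : R[i]^o := dotp K (A x) y.
have phi_lin : linear phi.
  by move=> c x1 x2; rewrite /phi linearP linearDl/= linearZl_LR.
pose phi' : {linear H -> R[i]^o} :=
  HB.pack phi (GRing.isLinear.Build _ _ _ _ phi phi_lin).
have phi_bounded x' : rnorm (phi' x') <= M * rnorm y * rnorm x'.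
  apply: (le_trans (cauchy_schwarz (dotp_norm (r:=K)) _ _)).
  by rewrite mulrAC ler_wpM2r ?rnorm_ge0.
have [z zP] := riesz (dotp_norm (r:=H)) phi_bounded.
by apply: (@xgetPex _ 0
  [set z : H | forall x : H, dotp K (A x) y = dotp H x z]); exists z.
Qed.

(** [|A^* y|^2 = <A (A^* y), y> <= M |A^* y| |y|]. It ensures that the supremum
defining the Berezin norm of the adjoint is over a bounded set. *)
Lemma adjoint_bounded (A : {linear H -> K}) (M : R) : 0 <= M -> continuous A ->
  (forall x, rnorm (A x) <= M * rnorm x) ->
  forall y, rnorm (adjoint A y) <= M * rnorm y.
Proof.
move=> M0 /adjointP adjA AM y; set z := adjoint A y.
have [z0|z0] := eqVneq (rnorm z) 0.
  by rewrite z0 mulr_ge0 ?rnorm_ge0.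
have zpos : 0 < rnorm z by rewrite lt_def z0 rnorm_ge0.
rewrite -(ler_pM2r zpos).
have -> : rnorm z * rnorm z = rnorm (dotp K (A z) y).
  rewrite adjA dotp_norm [in RHS]/rnorm normrX normr_id normE_rnorm.
  by rewrite -rmorphXn.
apply: (le_trans (cauchy_schwarz (dotp_norm (r:=K)) _ _)).
by rewrite mulrAC ler_wpM2r ?rnorm_ge0.
Qed.

End BoundedOperators.

(** * Berezin quantities as upper bounds *)

Section Suprema.
Variable R : realType.
Variables (Omega Omega' : Type) (H : rkhs R Omega) (K : rkhs R Omega').
Hypothesis kernel_neq0 : forall l, rker H l != 0.

Lemma rnorm_nker l : rnorm (nker H l) = 1.
Proof.
rewrite /nker rnormZ {1}/rnorm normfV normr_id normE_rnorm -fmorphV/=.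
by rewrite mulVf ?rnorm_eq0.
Qed.

Lemma rnorm_le_ber_norm (A : H -> K) (M : R) :
  (forall x, rnorm (A x) <= M * rnorm x) ->
  forall l, rnorm (A (nker H l)) <= ber_norm A.
Proof.
move=> AM l; apply: ub_le_sup; last by exists l.
by exists M => _ [l' _ <-]; have := AM (nker H l'); rewrite rnorm_nker mulr1.
Qed.

Lemma rnorm_le_ber (A : H -> H) (M : R) :
  (forall x, rnorm (A x) <= M * rnorm x) ->
  forall l, rnorm (dotp H (A (nker H l)) (nker H l)) <= ber A.
Proof.
move=> AM l; apply: ub_le_sup; last by exists l.
exists M => _ [l' _ <-].
apply: (le_trans (cauchy_schwarz (dotp_norm (r:=H)) _ _)).
by have := AM (nker H l'); rewrite rnorm_nker !mulr1.
Qed.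

End Suprema.

(** With [x = A k_l], [y = B^* k_l] and [e = k_m], this is [add_inner_unit_le],
as [<x, y> = <B A k_l, k_l>]. *)
Lemma ber_cross_terms_le (R : realType) (Omega Omega' : Type)
    (H : rkhs R Omega) (K : rkhs R Omega')
    (rkerH : forall l, rker H l != 0) (rkerK : forall l, rker K l != 0)
    (A : {linear H -> K}) (B : {linear K -> H})
    (Ac : continuous A) (Bc : continuous B) l m :
  rnorm (dotp K (A (nker H l)) (nker K m)) +
  rnorm (dotp H (B (nker K m)) (nker H l)) <=
  Num.sqrt ((ber_norm A + ber_norm (adjoint B)) ^+ 2
     - (ber_norm A * ber_norm (adjoint B) - ber (B \o A))).
Proof.
have [MA MA0 AM] := continuous_linear_rnorm_bounded Ac.
have [MB MB0 BM] := continuous_linear_rnorm_bounded Bc.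
have BsM := adjoint_bounded MB0 Bc BM.
have a_le := rnorm_le_ber_norm rkerH AM l.
have b_le := rnorm_le_ber_norm rkerH BsM l.
have ba_le : rnorm (dotp H (B (A (nker H l))) (nker H l)) <= ber (B \o A).
  apply: (@rnorm_le_ber _ _ _ rkerH (B \o A) (MB * MA)) => x /=.
  by rewrite -mulrA (le_trans (BM _))// ler_wpM2l.
rewrite (adjointP Bc) in ba_le.
rewrite (adjointP Bc).
set x := A (nker H l) in a_le ba_le *.
set y := adjoint B (nker H l) in b_le ba_le *.
have := add_inner_unit_le (dotp_norm (r:=K)) x y (rnorm_nker rkerK m).
set s := _ + rnorm (dotp K (nker K m) y) => s_le.
have s0 : 0 <= s by rewrite addr_ge0 ?rnorm_ge0.
rewrite -(ger0_norm s0) -sqrtr_sqr ler_wsqrtr// (le_trans s_le)//.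
have xx := ler_pM (rnorm_ge0 x) (rnorm_ge0 x) a_le a_le.
have yy := ler_pM (rnorm_ge0 y) (rnorm_ge0 y) b_le b_le.
have xy := ler_pM (rnorm_ge0 x) (rnorm_ge0 y) a_le b_le.
by rewrite !expr2; lra.
Qed.

(** * Comparison of quadratic forms *)

(** The weights [u_i u_j] are symmetric, so each quadratic form only sees the
symmetric part of its coefficients. This is what allows the bound for a pair of
off-diagonal entries to be stored in the upper triangle alone. *)
Lemma sum_sym_le (R : realType) (n : nat) (u : 'I_n -> R)
    (t m : 'I_n -> 'I_n -> R) :
  (forall i, 0 <= u i) ->
  (forall i j, t i j + t j i <= m i j + m j i) ->
  \sum_i \sum_j u i * u j * t i j <= \sum_i \sum_j u i * u j * m i j.
Proof.
move=> u0 tm.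
have dbl (s : 'I_n -> 'I_n -> R) : 2 * \sum_i \sum_j u i * u j * s i j =
    \sum_i \sum_j u i * u j * (s i j + s j i).
  rewrite mulr2n mulrDl mul1r {2}exchange_big/= -big_split/=.
  apply: eq_bigr => i _; rewrite -big_split/=; apply: eq_bigr => j _.
  by rewrite mulrDr [u j * u i]mulrC.
rewrite -(@ler_pM2l _ 2)// !dbl; apply: ler_sum => i _; apply: ler_sum => j _.
by rewrite ler_wpM2l// mulr_ge0.
Qed.

Lemma le_numerical_radius (R : realType) (n : nat) (M : 'M[R[i]]_n)
    (x : 'cV[R[i]]_n) :
  Num.sqrt (\sum_i rnorm (x i 0) ^+ 2) = 1 ->
  rnorm (\sum_i (M *m x) i 0 * Num.conj (x i 0)) <= numerical_radius M.
Proof.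
move=> x1; apply: ub_le_sup; last by exists x.
(* Entries of a unit vector have modulus at most 1. *)
exists (\sum_i \sum_j rnorm (M i j)) => _ [y /= y1 <-].
have y_le i : rnorm (y i 0) <= 1.
  have : Num.sqrt (rnorm (y i 0) ^+ 2) <= 1.
    rewrite -y1 ler_wsqrtr// (bigD1 i)//= lerDl.
    by apply: sumr_ge0 => j _; rewrite sqr_ge0.
  by rewrite sqrtr_sqr ger0_norm ?rnorm_ge0.
apply: (le_trans (ler_rnorm_sum _ _)); apply: ler_sum => i _.
rewrite rnormM rnorm_conj mxE.
apply: (@le_trans _ _ (rnorm (\sum_j M i j * y j 0))).
  by rewrite ler_piMr ?rnorm_ge0.
apply: (le_trans (ler_rnorm_sum _ _)); apply: ler_sum => j _.
by rewrite rnormM ler_piMr ?rnorm_ge0.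
Qed.

(** * The Berezin radius of an operator matrix *)

Theorem theorem1p4 (R : realType) (n : nat) (n_gt0 : (0 < n)%N)
    (Omega : 'I_n -> Type) (Omega_ne : forall i, inhabited (Omega i))
    (H : forall i, rkhs R (Omega i))
    (kernel_neq0 : forall i (l : Omega i), rker (H i) l != 0)
    (A : forall i j, {linear H j -> H i})
    (A_bounded : forall i j, continuous (A i j)) :
  dsum_ber (opmx A) <=
  numerical_radius (\matrix_(i < n, j < n)
    (if i == j then ber (A i i)
     else if (i < j)%N then
       Num.sqrt ((ber_norm (A i j) + ber_norm (adjoint (A j i))) ^+ 2
                 - (ber_norm (A i j) * ber_norm (adjoint (A j i))
                    - ber (A j i \o A i j)))
     else 0)%:C%C).
Proof.
set m := fun i j : 'I_n => if i == j then ber (A i i) else if (i < j)%N then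
    Num.sqrt ((ber_norm (A i j) + ber_norm (adjoint (A j i))) ^+ 2
     - (ber_norm (A i j) * ber_norm (adjoint (A j i)) - ber (A j i \o A i j)))
   else 0.
set M := (X in numerical_radius X).
apply: ge_sup.
  by eexists; exists (fun i => inhabited_witness (Omega_ne i)).
move=> _ [l _ <-].
pose t i j := rnorm (dotp (H i) (A i j (nker (H j) (l j))) (nker (H i) (l i))).
pose N := dsum_norm (dsum_rker H l).
(* The normalized kernel of the direct sum has i-th component u i times the
   normalized kernel of the i-th space. *)
pose u i := N^-1 * rnorm (rker (H i) (l i)).
have N_gt0 : 0 < N.
  rewrite sqrtr_gt0 (bigD1 (Ordinal n_gt0))//= ltr_wpDr//.
    by apply: sumr_ge0 => i _; rewrite sqr_ge0.
  by rewrite exprn_gt0// rnorm_gt0 kernel_neq0.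
have u_ge0 i : 0 <= u i by rewrite mulr_ge0 ?rnorm_ge0// invr_ge0 ltW.
have u_unit : \sum_i u i ^+ 2 = 1.
  under eq_bigr do rewrite exprMn.
  rewrite -mulr_sumr -[X in _ * X]sqr_sqrtr; last first.
    by apply: sumr_ge0 => i _; rewrite sqr_ge0.
  by rewrite -exprMn mulVf ?expr1n// gt_eqF.
have nkerE i : dsum_nker H l i = (u i)%:C%C *: nker (H i) (l i).
  rewrite /dsum_nker /dsum_rker /nker normE_rnorm scalerA -fmorphV -rmorphM/=.
  by rewrite /u mulfK ?rnorm_eq0 ?kernel_neq0.
have dotAZ i j c d (v : H j) (w : H i) :
    dotp (H i) (A i j (c *: v)) (d *: w) =
    c * (Num.conj d * dotp (H i) (A i j v) w).
  by rewrite linearZr_LR linearZ/= linearZl_LR mulrCA.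
have t_le i j : t i j + t j i <= m i j + m j i.
  have diag k : t k k <= m k k.
    rewrite /m eqxx.
    have [MA _ AM] := continuous_linear_rnorm_bounded (A_bounded k k).
    exact: rnorm_le_ber AM (l k).
  case: (ltngtP i j) => [ij|ji|/val_inj <-]; last exact: lerD.
  - rewrite /m eq_sym -val_eqE/= (gtn_eqF ij) ij ltnNge (ltnW ij)/= addr0.
    exact: ber_cross_terms_le.
  - rewrite addrC [leRHS]addrC.
    rewrite /m eq_sym -val_eqE/= (gtn_eqF ji) ji ltnNge (ltnW ji)/= addr0.
    exact: ber_cross_terms_le.
apply: (@le_trans _ _ (\sum_i \sum_j u i * u j * t i j)).
  rewrite /dsum_dotp /opmx; apply: (le_trans (ler_rnorm_sum _ _)).
  apply: ler_sum => i _.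
  rewrite linear_sumlz; apply: (le_trans (ler_rnorm_sum _ _)).
  apply: ler_sum => j _; rewrite !nkerE/= dotAZ.
  rewrite !rnormM rnorm_conj !rnorm_real !ger0_norm// /t.
  by rewrite mulrA [u j * u i]mulrC.
apply: (le_trans (sum_sym_le u_ge0 t_le)).
pose x : 'cV[R[i]]_n := \col_i (u i)%:C%C.
have x_unit : Num.sqrt (\sum_i rnorm (x i 0) ^+ 2) = 1.
  rewrite -sqrtr1 -u_unit; congr Num.sqrt; apply: eq_bigr => i _.
  by rewrite mxE rnorm_real ger0_norm.
apply: (le_trans _ (le_numerical_radius M x_unit)).
have -> : \sum_i (M *m x) i 0 * Num.conj (x i 0) =
    (\sum_i \sum_j u i * u j * m i j)%:C%C.
  rewrite rmorph_sum; apply: eq_bigr => i _; rewrite rmorph_sum mxE mulr_suml.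
  apply: eq_bigr => j _; rewrite !mxE.
  have -> : Num.conj ((u i)%:C%C : R[i]) = (u i)%:C%C by exact: conjc_real.
  rewrite -!rmorphM /=; congr (_%:C%C).
  by rewrite -/(m i j) -mulrA mulrC [u j * _]mulrC.
by rewrite rnorm_real ler_norm.
Qed.
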